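(* Let $n\ge 1$, let $\alpha_0,\dots,\alpha_{n-1}\in\mathbb{D}$ and $\lambda\in\partial\mathbb{D}$. Let $A$ be the compressed multiplication operator on $\mathcal{P}_{n-1}$ with Verblunsky coefficients $\{\alpha_j\}_{j=0}^{n-1}$, let $w_1,\dots,w_{n+1}\in\partial\mathbb{D}$ be the zeros of $\Phi_{n+1}(z;\lambda)$ in cyclic order, with $w_{n+2}:=w_1$, let $\eta_j$ be the normalized eigenvector of $U_\lambda$ with eigenvalue $w_j$, and let $m_j=|\langle\eta_j,\varphi_n\rangle|^2$, with $m_{n+2}:=m_1$. Then for each $j=1,\dots,n+1$, the line from $w_j$ to $w_{j+1}$ intersects the numerical range $N(A)$ in a single point $\zeta_j$, and $$\frac{|\zeta_j-w_j|}{|\zeta_j-w_{j+1}|}=\frac{m_j}{m_{j+1}}.$$ In particular, $\prod_{j=1}^{n+1}|\zeta_j-w_j|=\prod_{j=1}^{n+1}|\zeta_j-w_{j+1}|$.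
   Context: $\mathbb{D}$ is the open unit disk. For a polynomial $P$ regarded as having degree $k$, $P^*(z)=z^k\overline{P(1/\bar z)}$. Given $\alpha_0,\dots,\alpha_{n-1}\in\mathbb{D}$ (Verblunsky coefficients), define monic polynomials by $\Phi_0=1$ and Szegő recursion $\Phi_{j+1}(z)=z\Phi_j(z)-\overline{\alpha_j}\,\Phi_j^*(z)$, $0\le j\le n-1$. Put $\rho_j=\sqrt{1-|\alpha_j|^2}$ and $\varphi_j=\Phi_j/(\rho_0\cdots\rho_{j-1})$. For $\lambda\in\partial\mathbb{D}$ the paraorthogonal polynomial (POPUC) is $\Phi_{n+1}(z;\lambda)=z\Phi_n(z)-\bar\lambda\,\Phi_n^*(z)$; it has $n+1$ distinct zeros, all on $\partial\mathbb{D}$. There is a unique probability measure $d\mu^\lambda$ supported exactly on these zeros for which $\varphi_0,\dots,\varphi_n$ are orthonormal in $L^2(\partial\mathbb{D},d\mu^\lambda)$. This $L^2$ space is identified with $\mathcal{P}_n$, the polynomials of degree at most $n$ (the resulting inner product on $\mathcal{P}_n$ does not depend on $\lambda$, since $\{\varphi_j\}_{j=0}^n$ is an orthonormal basis). $U_\lambda$ is the unitary operator of multiplication by $z$ on $L^2(\partial\mathbb{D},d\mu^\lambda)\cong\mathcal{P}_n$; its eigenvalues are the zeros $w_j$ of $\Phi_{n+1}(z;\lambda)$, with normalized eigenvectors $\eta_j(z)=N_j^{-1}\Phi_{n+1}(z;\lambda)/(z-w_j)$, $N_j>0$. The compressed multiplication operator $A$ with Verblunsky coefficients $\{\alpha_j\}_{j=0}^{n-1}$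 is the compression of $U_\lambda$ to $\mathcal{P}_{n-1}$ (the orthogonal complement of $\varphi_n$ in $\mathcal{P}_n$), i.e. $A=PU_\lambda P\restriction\mathcal{P}_{n-1}$ with $P$ the orthogonal projection onto $\mathcal{P}_{n-1}$; it does not depend on $\lambda$. The numerical range is $N(A)=\{\langle\psi,A\psi\rangle:\|\psi\|=1\}$. *)

(* Defs.v *)
From mathcomp Require Import all_boot all_order all_algebra.
From mathcomp Require Import complex.
From mathcomp Require Import classical_sets reals trigo.

Set Implicit Arguments.
Unset Strict Implicit.
Unset Printing Implicit Defensive.

Import Order.TTheory GRing.Theory Num.Theory.

Local Open Scope ring_scope.
Local Open Scope complex_scope.
Local Open Scope classical_set_scope.

Section Szego.
Variable R : realType.
Implicit Types (alpha : nat -> R[i]) (lambda : R[i]) (p : {poly R[i]}).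

(* P^*(z) = z^k conj(P(1 / conj z)) for deg P <= k, coefficientwise: the
   coefficient of z^i is the conjugate of the coefficient of z^(k-i). *)
Definition reversed_poly (k : nat) p : {poly R[i]} :=
  \poly_(i < k.+1) (p`_(k - i))^*.

(* Only alpha 0, ..., alpha (n - 1) enter the objects of level n below. *)
Fixpoint Phi alpha (j : nat) : {poly R[i]} :=
  if j is k.+1
  then 'X * Phi alpha k - (alpha k)^* *: reversed_poly k (Phi alpha k)
  else 1.

Definition rho alpha (j : nat) : R[i] := sqrtC (1 - `|alpha j| ^+ 2).

Definition phi alpha (j : nat) : {poly R[i]} :=
  (\prod_(k < j) rho alpha k)^-1 *: Phi alpha j.

Definition popuc alpha lambda (n : nat) : {poly R[i]} :=
  'X * Phi alpha n - lambda^* *: reversed_poly n (Phi alpha n).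

End Szego.

Section CyclicOrder.
Variable R : realType.

Definition expi (t : R) : R[i] := cos t +i* sin t.

(* Distinct points of the unit circle listed in the order in which they are met
   when the circle is traversed once, in either direction. *)
Definition cyclically_ordered (N : nat) (w : 'I_N -> R[i]) : Prop :=
  exists theta : 'I_N -> R,
    [/\ forall j, w j = expi (theta j),
        (forall j k : 'I_N, (j < k)%N -> theta j < theta k) \/
        (forall j k : 'I_N, (j < k)%N -> theta k < theta j)
      & forall j k : 'I_N, `|theta j - theta k| < 2 * pi].

Definition line (a b : R[i]) : set (R[i]) :=
  [set z | exists t : R, z = (1 - t)%:C * a + t%:C * b].

Definition segment (a b : R[i]) : set (R[i]) :=
  [set z | exists2 t : R, 0 <= t <= 1 & z = (1 - t)%:C * a + t%:C * b].

End CyclicOrder.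

(* L^2 of the measure with mass mu j at the point w j; its elements are the
   functions on the support, f j being the value at w j. The inner product is
   antilinear in its first argument. *)
Section L2.
Variables (R : realType) (N : nat) (w : 'I_N -> R[i]) (mu : 'I_N -> R).
Implicit Types (f g : {ffun 'I_N -> R[i]}) (p : {poly R[i]}).

Definition dotL2 f g : R[i] := \sum_j (mu j)%:C * ((f j)^* * g j).

Definition normL2 f : R[i] := sqrtC (dotL2 f f).

Definition toL2 p : {ffun 'I_N -> R[i]} := [ffun j => p.[w j]].

(* Polynomials of degree < d, as a subspace of L^2. *)
Definition polyL2 (d : nat) : set {ffun 'I_N -> R[i]} :=
  [set f | exists2 p : {poly R[i]}, (size p <= d)%N & f = toL2 p].

Definition mulzL2 f : {ffun 'I_N -> R[i]} := [ffun j => w j * f j].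

(* The default value 0 is never used when V is a linear subspace: the inner
   product being positive definite for mu > 0, the projection then exists and is
   unique. *)
Definition orthoprojL2 (V : set {ffun 'I_N -> R[i]}) f : {ffun 'I_N -> R[i]} :=
  xget 0 [set g | V g /\ forall h, V h -> dotL2 h (f - g) = 0].

Definition compression (V : set {ffun 'I_N -> R[i]})
    (T : {ffun 'I_N -> R[i]} -> {ffun 'I_N -> R[i]}) f :=
  orthoprojL2 V (T (orthoprojL2 V f)).

Definition numerical_range (V : set {ffun 'I_N -> R[i]})
    (T : {ffun 'I_N -> R[i]} -> {ffun 'I_N -> R[i]}) : set (R[i]) :=
  [set z | exists psi, [/\ V psi, normL2 psi = 1 & z = dotL2 psi (T psi)]].

End L2.

(* L^2 is identified with the polynomials of degree <= n through toL2 w. The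
   measure is to be used with w an enumeration of the zeros of popuc. The operator
   compressed_mul then depends on alpha through w and mu. *)
Section CompressedMultiplication.
Variables (R : realType) (alpha : nat -> R[i]) (lambda : R[i]) (n : nat).
Variables (w : 'I_n.+1 -> R[i]) (mu : 'I_n.+1 -> R).

Definition is_popuc_measure : Prop :=
  [/\ forall j, 0 < mu j,
      \sum_j mu j = 1
    & forall k l : nat, (k <= n)%N -> (l <= n)%N ->
        dotL2 mu (toL2 w (phi alpha k)) (toL2 w (phi alpha l)) = (k == l)%:R].

Definition compressed_mul : {ffun 'I_n.+1 -> R[i]} -> {ffun 'I_n.+1 -> R[i]} :=
  compression mu (polyL2 w n) (mulzL2 w).

Definition numrange_compressed_mul : set (R[i]) :=
  numerical_range mu (polyL2 w n) compressed_mul.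

Definition eigvec (j : 'I_n.+1) : {ffun 'I_n.+1 -> R[i]} :=
  let q := toL2 w (popuc alpha lambda n %/ ('X - (w j)%:P)) in
  (normL2 mu q)^-1 *: q.

Definition eigmass (j : 'I_n.+1) : R[i] :=
  `|dotL2 mu (eigvec j) (toL2 w (phi alpha n))| ^+ 2.

End CompressedMultiplication.

(* Main.v *)
(** With V the polynomials of degree < n, V is the orthogonal complement of
    [phi n], so the numerical range consists of the points
    [\sum_k mu_k |psi_k|^2 w_k] with psi a unit vector orthogonal to [phi n]. The
    line through the neighbours [w_j], [w_(j+1)] has all the other [w_k] strictly
    on one side, so on that line psi is supported at these two points, and
    orthogonality to [phi n] fixes [|psi_j|] and [|psi_(j+1)|]. The mass [m_j] is
    [mu_j |phi_n(w_j)|^2], because the eigenvector at [w_j] is a point mass. *)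

Require Import Defs.
From mathcomp Require Import all_boot all_order all_algebra.
From mathcomp Require Import complex ring lra.
From mathcomp Require Import classical_sets reals trigo.

Import Order.TTheory GRing.Theory Num.Theory.

Local Open Scope ring_scope.
Local Open Scope complex_scope.
Local Open Scope classical_set_scope.

(** * The weighted inner product on functions on the support *)

Section InnerProduct.
Variables (R : realType) (N : nat) (mu : 'I_N -> R).
Implicit Types (f g h e : {ffun 'I_N -> R[i]}) (V : set {ffun 'I_N -> R[i]}).

Lemma dotL2P a f g h : dotL2 mu f (a *: g + h) = a * dotL2 mu f g + dotL2 mu f h.
Proof.
rewrite /dotL2 mulr_sumr -big_split /=; apply: eq_bigr => j _.
by rewrite !ffunE /= !mulrDr [_ * (a * _)]mulrCA [_ * (a * _)]mulrCA.
Qed.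

Lemma dotL20 f : dotL2 mu f 0 = 0.
Proof. by rewrite /dotL2 big1 // => j _; rewrite ffunE !mulr0. Qed.

Lemma dotL2D f g h : dotL2 mu f (g + h) = dotL2 mu f g + dotL2 mu f h.
Proof. by rewrite -[g]scale1r dotL2P mul1r scale1r. Qed.

Lemma dotL2Z a f g : dotL2 mu f (a *: g) = a * dotL2 mu f g.
Proof. by rewrite -[a *: g]addr0 dotL2P dotL20 addr0. Qed.

Lemma dotL2B f g h : dotL2 mu f (g - h) = dotL2 mu f g - dotL2 mu f h.
Proof. by rewrite dotL2D -scaleN1r dotL2Z mulN1r. Qed.

Lemma conj_real (x : R) : (x%:C)^*%R = x%:C.
Proof. by apply: conj_Creal; apply/complex_realP; exists x. Qed.

Lemma dotL2C f g : (dotL2 mu f g)^*%R = dotL2 mu g f.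
Proof.
rewrite /dotL2 rmorph_sum; apply: eq_bigr => j _.
have conjM (x y : R[i]) : (x * y)^*%R = x^*%R * y^*%R by exact: rmorphM.
by rewrite -[LHS]/((_ * _)^*%R) !conjM conj_real conjCK [f j * _]mulrC.
Qed.

Lemma dotL2_real f : dotL2 mu f f = \sum_j (mu j)%:C * `|f j| ^+ 2.
Proof. by apply: eq_bigr => j _; rewrite normCK [f j * _]mulrC. Qed.

Lemma normL2_eq1 f : normL2 mu f = 1 <-> dotL2 mu f f = 1.
Proof.
split=> [h|]; last by rewrite /normL2 => ->; rewrite sqrtC1.
by rewrite -[LHS]sqrtCK -/(normL2 mu f) h expr1n.
Qed.

Hypothesis mu_gt0 : forall j, 0 < mu j.

Lemma dotL2_eq0 f : dotL2 mu f f = 0 -> f = 0.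
Proof.
rewrite dotL2_real => /psumr_eq0P h; apply/ffunP => j; rewrite ffunE.
have muC k : 0 < (mu k)%:C by rewrite (ltcR 0).
have /eqP := h (fun k _ => mulr_ge0 (ltW (muC k)) (exprn_ge0 2 (normr_ge0 (f k)))) j isT.
by rewrite mulf_eq0 gt_eqF //= expf_eq0 /= normr_eq0 => /eqP.
Qed.

(** * Compression to the orthogonal complement of a unit vector *)

Section Hyperplane.
Variables (V : set {ffun 'I_N -> R[i]}) (e : {ffun 'I_N -> R[i]}).
Hypotheses (VP : forall f, V f <-> dotL2 mu e f = 0) (e1 : dotL2 mu e e = 1).

(** Subtracting from [f] its component along [e] gives a projection, so the set under [xget] is
    nonempty and the default value does not occur. *)
Lemma orthoprojL2P f :
  V (orthoprojL2 mu V f) /\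
  forall h, V h -> dotL2 mu h (f - orthoprojL2 mu V f) = 0.
Proof.
rewrite /orthoprojL2.
apply: (@xgetPex _ 0 [set g | V g /\ forall h, V h -> dotL2 mu h (f - g) = 0]).
exists (f - dotL2 mu e f *: e); split=> [|h /VP eh].
  by apply/VP; rewrite dotL2B dotL2Z e1 mulr1 subrr.
by rewrite opprB addrCA subrr addr0 dotL2Z -[dotL2 mu h e]dotL2C eh conjC0 mulr0.
Qed.

Lemma orthoprojL2_id f : V f -> orthoprojL2 mu V f = f.
Proof.
move=> Vf; have [Vg fg] := orthoprojL2P f.
apply/esym/eqP; rewrite -subr_eq0; apply/eqP/dotL2_eq0/fg.
by apply/VP; rewrite dotL2B !(VP _).1 // subrr.
Qed.

(** The inner projection fixes [psi], and the outer one changes [T psi] only by a vector orthogonal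
    to [psi]. *)
Lemma numerical_range_compression (T : {ffun 'I_N -> R[i]} -> {ffun 'I_N -> R[i]}) z :
  numerical_range mu V (compression mu V T) z <->
  exists psi, [/\ V psi, dotL2 mu psi psi = 1 & z = dotL2 mu psi (T psi)].
Proof.
have compr psi : V psi -> dotL2 mu psi (compression mu V T psi) = dotL2 mu psi (T psi).
  move=> Vpsi; rewrite /compression (orthoprojL2_id psi) //.
  by apply/esym/eqP; rewrite -subr_eq0 -dotL2B (orthoprojL2P _).2.
by split=> -[psi [Vpsi /normL2_eq1 psi1 ->]]; exists psi; split; rewrite ?compr //;
  apply/normL2_eq1.
Qed.

End Hyperplane.
End InnerProduct.

(** * Cyclically ordered points of the circle and the supporting lines of their edges *)

Section CyclicOrder.
Variable R : realType.
Implicit Types x y a b t : R.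

(** The half-angle lies in (-pi, pi), where the sine has the sign of its argument. *)
Lemma mul_sin_half_gt0 x : x != 0 -> `|x| < 2 * pi -> 0 < x * sin (x / 2).
Proof.
wlog x0 : x / 0 < x => [hw xn0 xpi|_].
  have [x0|x0] := ltP 0 x; first exact: hw.
  have := hw (- x); rewrite oppr_gt0 lt_neqAle xn0 x0 oppr_eq0 normrN => /(_ isT xn0 xpi).
  by rewrite [- x / 2]mulNr sinN mulrNN.
rewrite gtr0_norm // => xpi; rewrite mulr_gt0 // sin_gt0_pi //.
by apply/andP; split; lra.
Qed.

Lemma mul_sin_half2_gt0 s x y : s * s = 1 -> `|x| < 2 * pi -> `|y| < 2 * pi ->
  0 < s * (x * y) -> 0 < s * (sin (x / 2) * sin (y / 2)).
Proof.
move=> s1 xpi ypi sxy; rewrite -(pmulr_rgt0 _ sxy).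
have x0 : x != 0 by apply: contraTneq sxy => ->; rewrite mul0r mulr0 ltxx.
have y0 : y != 0 by apply: contraTneq sxy => ->; rewrite !mulr0 ltxx.
have -> : s * (x * y) * (s * (sin (x / 2) * sin (y / 2)))
  = (s * s) * ((x * sin (x / 2)) * (y * sin (y / 2))) by ring.
by rewrite s1 mul1r mulr_gt0 // mul_sin_half_gt0.
Qed.

(* The right side is affine in the point [expi t] and vanishes on the line through
   [expi a] and [expi b]; the product shows on which side of it [expi t] lies. *)
Lemma sin_half_chord a b t :
  sin ((t - a) / 2) * sin ((t - b) / 2) =
  - (cos ((a + b) / 2) / 2) * cos t + - (sin ((a + b) / 2) / 2) * sin t
    + cos ((b - a) / 2) / 2.
Proof.
have -> : (b - a) / 2 = (t - a) / 2 - (t - b) / 2 by field.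
have := cosD ((t - a) / 2) ((t - b) / 2).
have -> : (t - a) / 2 + (t - b) / 2 = t - (a + b) / 2 by field.
by rewrite !cosB => h; lra.
Qed.

(** The sign [s] tells whether the other angles lie outside the two consecutive ones or, for the
    edge that closes the cycle, between them. *)
Lemma monotone_consecutive (n : nat) (theta : 'I_n.+1 -> R) (j : 'I_n.+1) :
    ((forall j k : 'I_n.+1, (j < k)%N -> theta j < theta k) \/
     (forall j k : 'I_n.+1, (j < k)%N -> theta k < theta j)) ->
  exists2 s : R, s * s = 1 & forall k, k != j -> k != ordS j ->
    0 < s * ((theta k - theta j) * (theta k - theta (ordS j))).
Proof.
wlog inc : theta / (forall j k : 'I_n.+1, (j < k)%N -> theta j < theta k).
  move=> hw [inc|dec]; first by apply: hw => //; left.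
  (* Negating all angles makes the list increasing and leaves each product of two differences
     unchanged. *)
  have dec' (i k : 'I_n.+1) : (i < k)%N -> - theta i < - theta k.
    by rewrite ltrN2; exact: dec.
  have [s s1 hs] := hw (fun k => - theta k) dec' (or_introl dec').
  exists s => // k kj kSj.
  by move: (hs k kj kSj); rewrite -!opprD mulrNN.
move=> _; have [jn|jn] := eqVneq (j : nat) n.
  (* The closing edge joins the last angle to the first, and every other angle lies strictly between
     them. *)
  exists (-1) => [|k kj kSj]; first by rewrite mulrNN mulr1.
  have Sj0 : ordS j = 0 :> nat by rewrite /= jn modnn.
  have kj' : (k < j)%N by rewrite ltn_neqAle -(inj_eq val_inj) /= in kj *; rewrite kj jn -ltnS /=.
  have kSj' : (ordS j < k)%N.
    by rewrite ltn_neqAle Sj0 eq_sym -Sj0 (inj_eq val_inj) kSj Sj0.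
  by have := inc _ _ kj'; have := inc _ _ kSj'; nra.
have Sj : ordS j = j.+1 :> nat.
  by rewrite /= modn_small // ltnS ltn_neqAle jn -ltnS /=.
exists 1 => [|k kj kSj]; first by rewrite mulr1.
have jSj : theta j < theta (ordS j) by apply: inc; rewrite Sj.
case: (ltngtP (k : nat) j) => [/inc|kj'|/val_inj/eqP]; last by rewrite (negbTE kj).
  by nra.
have /inc : (ordS j < k)%N.
  by rewrite ltn_neqAle Sj kj' andbT -Sj eq_sym (inj_eq val_inj).
by nra.
Qed.

(** The affine function [g] is the product of sines in [sin_half_chord], oriented by the sign from
    [monotone_consecutive]. *)
Lemma cyclic_edge_support (n : nat) (w : 'I_n.+1 -> R[i]) (j : 'I_n.+1) :
    cyclically_ordered w ->
  exists p q r : R, let g z := p * complex.Re z + q * complex.Im z + r in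
    [/\ g (w j) = 0, g (w (ordS j)) = 0
      & forall k, k != j -> k != ordS j -> 0 < g (w k)].
Proof.
case=> theta [wE mono dist].
have [s s1 hs] := monotone_consecutive _ _ j mono.
set a := theta j; set b := theta (ordS j).
exists (s * - (cos ((a + b) / 2) / 2)), (s * - (sin ((a + b) / 2) / 2)),
  (s * (cos ((b - a) / 2) / 2)) => g.
have gE k : g (w k) = s * (sin ((theta k - a) / 2) * sin ((theta k - b) / 2)).
  by rewrite /g wE sin_half_chord /=; ring.
split=> [||k kj kSj]; rewrite gE.
- by rewrite subrr mul0r sin0 mul0r mulr0.
- by rewrite subrr mul0r sin0 !mulr0.
- exact: (mul_sin_half2_gt0 _ _ _ s1 (dist _ _) (dist _ _) (hs _ kj kSj)).
Qed.

(** If two points agree, the chord identity with equal end points makes the squared sine of half the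
    angle difference vanish; distinct angles less than 2 pi apart exclude this. *)
Lemma cyclically_ordered_inj (n : nat) (w : 'I_n -> R[i]) :
  cyclically_ordered w -> injective w.
Proof.
case=> theta [wE mono dist] i k wik; apply/eqP/negP => /negP ik.
have : theta i - theta k != 0.
  rewrite subr_eq0; have [ki|ki|/val_inj/eqP] := ltngtP (i : nat) k; last by rewrite (negbTE ik).
    by case: mono => /(_ _ _ ki); [move/lt_eqF->|move/gt_eqF->].
  by case: mono => /(_ _ _ ki); [move/gt_eqF->|move/lt_eqF->].
move=> /mul_sin_half_gt0/(_ (dist i k)).
have := sin_half_chord (theta k) (theta k) (theta i).
have -> : (theta k + theta k) / 2 = theta k by field.
rewrite subrr mul0r cos0.
move: wik; rewrite !wE => -[-> ->].
have := cos2Dsin2 (theta k); set x := sin _; set c := cos _; set y := sin _ => h1 h2 h3.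
have /eqP : y * y = 0 by lra.
by rewrite mulf_eq0 orbb => /eqP y0; rewrite y0 mulr0 ltxx in h3.
Qed.

(** The supporting function of the edge vanishes on the line, so its weighted sum over the points is
    0. All terms are nonnegative, hence zero, and the function is positive off the edge. *)
Lemma line_convex_support (n : nat) (w : 'I_n.+1 -> R[i]) (a : 'I_n.+1 -> R)
    (j : 'I_n.+1) :
    cyclically_ordered w -> (forall k, 0 <= a k) -> \sum_k a k = 1 ->
    line (w j) (w (ordS j)) (\sum_k (a k)%:C * w k) ->
  forall k, k != j -> k != ordS j -> a k = 0.
Proof.
move=> wc a0 a1 [t zE] k kj kSj.
have [p [q [r]]] := cyclic_edge_support _ _ j wc; set g := fun z => _ => -[gj gSj gk].
have Re_sum : complex.Re (\sum_k (a k)%:C * w k) = \sum_k a k * complex.Re (w k).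
  rewrite (big_morph (@complex.Re R) (id1 := 0) (op1 := +%R)) //; last by case=> ? ? [].
  by apply: eq_bigr => i _; case: (w i) => x y /=; rewrite mul0r subr0.
have Im_sum : complex.Im (\sum_k (a k)%:C * w k) = \sum_k a k * complex.Im (w k).
  rewrite (big_morph (@complex.Im R) (id1 := 0) (op1 := +%R)) //; last by case=> ? ? [].
  by apply: eq_bigr => i _; case: (w i) => x y /=; rewrite mul0r addr0.
have : \sum_k a k * g (w k) = 0.
  transitivity (g (\sum_k (a k)%:C * w k)); last first.
    rewrite zE; case: (w j) (w (ordS j)) gj gSj => [x y] [x' y'].
    rewrite /g /= => gj gSj.
    transitivity ((1 - t) * (p * x + q * y + r) + t * (p * x' + q * y' + r)).
      by ring.
    by rewrite gj gSj !mulr0 addr0.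
  (* The constant [r] is spread over the terms through the total weight 1. *)
  rewrite /g Re_sum Im_sum -[r in RHS]mulr1 -a1 !mulr_sumr -!big_split /=.
  by apply: eq_bigr => i _; ring.
have gw0 i : 0 <= g (w i).
  have [->|ij] := eqVneq i j; first by rewrite gj.
  have [->|iSj] := eqVneq i (ordS j); first by rewrite gSj.
  exact/ltW/gk.
move=> /psumr_eq0P h.
have /eqP := h (fun i _ => mulr_ge0 (a0 i) (gw0 i)) k isT.
by rewrite mulf_eq0 (gt_eqF (gk k kj kSj)) orbF => /eqP.
Qed.

End CyclicOrder.

(** * Degrees and leading coefficients in the Szego recursion *)

Section Szego.
Variable R : realType.
Implicit Types (alpha : nat -> R[i]) (c lambda : R[i]) (p : {poly R[i]}).

(** The coefficient [c] is arbitrary, to serve both the recursion for [Phi] and the step that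
    defines [popuc]. *)
Lemma szego_step_monic c (k : nat) p : p \is monic -> size p = k.+1 ->
  'X * p - c *: reversed_poly k p \is monic /\
  size ('X * p - c *: reversed_poly k p) = k.+2.
Proof.
move=> pm sp; have p0 : p != 0 by exact: monic_neq0.
have sXp : size ('X * p) = k.+2 by rewrite mulrC size_mulX // sp.
have lt : (size (- (c *: reversed_poly k p)) < size ('X * p)%R)%N.
  by rewrite sXp ltnS size_polyN (leq_trans (size_scale_leq _ _)) // size_poly.
by rewrite size_polyDl // sXp monicE lead_coefDl // lead_coefM lead_coefX mul1r -monicE.
Qed.

Lemma Phi_monic_size alpha k : Phi alpha k \is monic /\ size (Phi alpha k) = k.+1.
Proof.
elim: k => [|k [pm sp]]; first by rewrite /= monic1 size_poly1.
exact: szego_step_monic.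
Qed.

(** The descent step for expanding a polynomial in the monic [Phi]. *)
Lemma size_sub_Phi alpha d p : (size p <= d.+1)%N ->
  (size (p - p`_d *: Phi alpha d)%R <= d)%N.
Proof.
have [/monicP Pm Ps] := Phi_monic_size alpha d.
move=> /leq_sizeP sp; apply/leq_sizeP => i; rewrite leq_eqVlt => /orP[/eqP<-|di].
  have Pd : (Phi alpha d)`_d = 1 by rewrite -Pm lead_coefE Ps.
  by rewrite coefB coefZ Pd mulr1 subrr.
by rewrite coefB coefZ (sp i di) [(Phi alpha d)`_i]nth_default ?Ps // mulr0 subrr.
Qed.

End Szego.

(** * Polynomials of degree below [n] as the complement of [phi n], and the eigenvector masses *)

Section OrthonormalPolynomials.
Variables (R : realType) (n : nat) (alpha : nat -> R[i]) (lambda : R[i]).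
Variables (w : 'I_n.+1 -> R[i]) (mu : 'I_n.+1 -> R).
Hypothesis alpha_lt1 : forall j : nat, (j < n)%N -> `|alpha j| < 1.
Hypothesis w_inj : injective w.
Hypothesis w_root : forall j, root (popuc alpha lambda n) (w j).
Hypothesis mu_popuc : is_popuc_measure alpha w mu.

Local Notation V := (polyL2 w n).
Local Notation "'phi_n'" := (toL2 w (phi alpha n)).

Lemma toL2P a (p q : {poly R[i]}) : toL2 w (a *: p + q) = a *: toL2 w p + toL2 w q.
Proof. by apply/ffunP => j; rewrite !ffunE hornerD hornerZ. Qed.

Lemma mu_gt0 j : 0 < mu j. Proof. by case: mu_popuc. Qed.

Definition rho_prod k : R[i] := \prod_(i < k) rho alpha i.

Lemma rho_prod_neq0 k : (k <= n)%N -> rho_prod k != 0.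
Proof.
move=> kn; apply/prodf_neq0 => i _.
rewrite /rho sqrtC_eq0 subr_eq0 eq_sym lt_eqF // expr_lt1 //.
exact/alpha_lt1/(leq_trans (ltn_ord i)).
Qed.

Lemma Phi_phi k : (k <= n)%N -> Phi alpha k = rho_prod k *: phi alpha k.
Proof. by move=> kn; rewrite /phi scalerA mulfV ?scale1r // rho_prod_neq0. Qed.

Lemma dot_phi_Phi k : (k <= n)%N ->
  dotL2 mu phi_n (toL2 w (Phi alpha k)) = rho_prod k *+ (n == k).
Proof.
move=> kn; have [_ _ orth] := mu_popuc; rewrite Phi_phi //.
have -> : toL2 w (rho_prod k *: phi alpha k) = rho_prod k *: toL2 w (phi alpha k).
  by apply/ffunP => j; rewrite !ffunE hornerZ.
by rewrite dotL2Z orth // mulr_natr.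
Qed.

(** Induction on the degree bound: the top term is removed by a multiple of some [Phi alpha d] with
    [d < n], which is orthogonal to [phi n]. *)
Lemma dot_phi_poly d (p : {poly R[i]}) : (d <= n)%N -> (size p <= d)%N ->
  dotL2 mu phi_n (toL2 w p) = 0.
Proof.
elim: d p => [|d IH] p dn sp.
  move: sp; rewrite leqn0 size_poly_eq0 => /eqP->.
  have -> : toL2 w 0 = 0 by apply/ffunP => j; rewrite !ffunE horner0.
  exact: dotL20.
rewrite -[p](subrK (p`_d *: Phi alpha d)) addrC toL2P dotL2P dot_phi_Phi ?(ltnW dn) //.
by rewrite (gtn_eqF dn) mulr0 add0r (IH _ (ltnW dn)) // size_sub_Phi.
Qed.

Lemma dot_phi_lead (p : {poly R[i]}) : (size p <= n.+1)%N ->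
  dotL2 mu phi_n (toL2 w p) = p`_n * rho_prod n.
Proof.
move=> sp; rewrite -[p in LHS](subrK (p`_n *: Phi alpha n)) addrC toL2P dotL2P.
by rewrite dot_phi_Phi // eqxx mulr1n (dot_phi_poly n) ?addr0 // size_sub_Phi.
Qed.

(** Up to a scalar, the Lagrange interpolation polynomial at [w j]. *)
Definition cofactor_poly (j : 'I_n.+1) : {poly R[i]} :=
  \prod_(k | k != j) ('X - (w k)%:P).

(** The polynomial is monic of degree [n + 1] and has the [n + 1] distinct roots [w k]. *)
Lemma popuc_cofactor j : popuc alpha lambda n = ('X - (w j)%:P) * cofactor_poly j.
Proof.
have [Pm Ps] := Phi_monic_size R alpha n.
have [/monicP Qm Qs] := szego_step_monic R lambda^*%R n _ Pm Ps.
rewrite /popuc [LHS](@all_roots_prod_XsubC _ _ [seq w k | k : 'I_n.+1]).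
- by rewrite Qm scale1r big_image /= (bigD1 j).
- by rewrite Qs size_image card_ord.
- by apply/allP => z /mapP[k _ ->]; exact: w_root.
- by rewrite uniq_rootsE map_inj_uniq ?enum_uniq.
Qed.

Lemma popuc_div j : popuc alpha lambda n %/ ('X - (w j)%:P) = cofactor_poly j.
Proof. by rewrite (popuc_cofactor j) mulKp // polyXsubC_eq0. Qed.

Lemma cofactor_monic j : cofactor_poly j \is monic.
Proof. exact: monic_prod_XsubC. Qed.

Definition delta (j : 'I_n.+1) : {ffun 'I_n.+1 -> R[i]} := [ffun k => (k == j)%:R].

Lemma size_cofactor j : size (cofactor_poly j) = n.+1.
Proof.
have [Pm Ps] := Phi_monic_size R alpha n.
have [_ Qs] := szego_step_monic R lambda^*%R n _ Pm Ps.
have := popuc_cofactor j; rewrite /popuc => /(congr1 (fun p : {poly R[i]} => size p)).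
rewrite Qs size_Mmonic ?cofactor_monic ?polyXsubC_eq0 //.
by rewrite size_XsubC add2n /= => -[].
Qed.

Lemma cofactor_root_neq0 j : (cofactor_poly j).[w j] != 0.
Proof.
rewrite horner_prod; apply/prodf_neq0 => k kj.
by rewrite hornerXsubC subr_eq0 (inj_eq w_inj) eq_sym.
Qed.

(** This is why the eigenvector at [w j] is a multiple of a point mass. *)
Lemma toL2_cofactor j : toL2 w (cofactor_poly j) = (cofactor_poly j).[w j] *: delta j.
Proof.
apply/ffunP => k; rewrite !ffunE; have [->|kj] := eqVneq k j.
  by rewrite /= [_ *: _]mulr1.
by rewrite /= scaler0 horner_prod (bigD1 k) //= hornerXsubC subrr mul0r.
Qed.

Lemma dot_delta_r f j : dotL2 mu f (delta j) = (mu j)%:C * (f j)^*%R.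
Proof.
rewrite /dotL2 (bigD1 j) //= ffunE eqxx mulr1 big1 ?addr0 // => k kj.
by rewrite ffunE (negbTE kj) !mulr0.
Qed.

(** Pairing [phi n] with the monic [cofactor_poly j] of degree [n] gives the nonzero [rho_prod n],
    yet this pairing is a multiple of the conjugate of the value of [phi n] at [w j]. *)
Lemma phi_root_neq0 j : (phi alpha n).[w j] != 0.
Proof.
have := dot_phi_lead (cofactor_poly j); rewrite size_cofactor => /(_ (leqnn _)).
have -> : (cofactor_poly j)`_n = 1.
  by have := monicP (cofactor_monic j); rewrite lead_coefE size_cofactor.
rewrite mul1r toL2_cofactor dotL2Z dot_delta_r ffunE => h.
apply: contraTneq (rho_prod_neq0 n (leqnn n)) => p0.
by rewrite -h p0 conjC0 !mulr0 eqxx.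
Qed.

(** For the converse, [f] is interpolated by a polynomial of degree at most [n], and orthogonality
    to [phi n] kills its coefficient of degree [n]. *)
Lemma polyL2P f : V f <-> dotL2 mu phi_n f = 0.
Proof.
split=> [[p sp ->]|fn]; first exact: (dot_phi_poly n).
pose c j : R[i] := f j / (cofactor_poly j).[w j].
pose p : {poly R[i]} := \sum_j c j *: cofactor_poly j.
have pf : toL2 w p = f.
  apply/ffunP => k; rewrite ffunE horner_sum (bigD1 k) //= hornerZ.
  rewrite divfK ?cofactor_root_neq0 // big1 ?addr0 // => j jk.
  have /ffunP/(_ k) := toL2_cofactor j.
  by rewrite !ffunE eq_sym (negbTE jk) hornerZ => ->; rewrite [_ *: _]mulr0 mulr0.
have sp : (size p <= n.+1)%N.
  apply: (leq_trans (size_sum _ _ _)); apply/bigmax_leqP => j _.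
  by rewrite (leq_trans (size_scale_leq _ _)) // size_cofactor.
exists p => //; have := dot_phi_lead p sp.
rewrite pf fn => /esym/eqP; rewrite mulf_eq0 (negbTE (rho_prod_neq0 _ _)) ?leqnn // orbF.
by move/eqP => pn0; have := size_sub_Phi R alpha n p sp; rewrite pn0 scale0r subr0.
Qed.

(** The scalar [c] of the point mass cancels against the norm [N], which leaves a single factor
    [mu j]. *)
Lemma eigmassE j :
  eigmass alpha lambda w mu j = (mu j)%:C * `|(phi alpha n).[w j]| ^+ 2.
Proof.
rewrite /eigmass /eigvec popuc_div toL2_cofactor.
set c := _.[w j]; have c0 : c != 0 by exact: cofactor_root_neq0.
have m0 : 0 < (mu j)%:C by rewrite (ltcR 0) mu_gt0.
set N := normL2 _ _.
have N2 : `|N| ^+ 2 = (mu j)%:C * `|c| ^+ 2.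
  rewrite -normrX sqrtCK dotL2_real (bigD1 j) //= big1 => [|k kj].
    rewrite !ffunE eqxx [_ *: _]mulr1 addr0 ger0_norm //.
    by rewrite mulr_ge0 ?exprn_ge0 // ltW.
  by rewrite !ffunE (negbTE kj) scaler0 normr0 expr0n mulr0.
(* Conjugation moves the eigenvector into the linear argument and keeps the modulus. *)
rewrite -dotL2C norm_conjC !dotL2Z dot_delta_r ffunE !normrM norm_conjC normfV.
rewrite !exprMn exprVn N2 (gtr0_norm m0).
have cancel (F : fieldType) (a b x : F) : a != 0 -> b != 0 ->
  (a * b)^-1 * (b * (a ^+ 2 * x)) = a * x.
  by move=> a0 b0; field; apply/andP.
by apply: cancel; [rewrite gt_eqF | rewrite expf_neq0 ?normr_eq0].
Qed.

End OrthonormalPolynomials.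

(** * Quadratic forms with real weights *)

Section NumericalRange.
Variable R : realType.

(** The squared modulus as an element of [R], so that weights and masses can be handled by real
    arithmetic. *)
Definition sqnormc (z : R[i]) : R := complex.Re z ^+ 2 + complex.Im z ^+ 2.

Lemma realM (x y : R) : (x * y)%:C = x%:C * y%:C.
Proof. exact: rmorphM. Qed.

Lemma sqnormcE z : (sqnormc z)%:C = `|z| ^+ 2.
Proof. exact: add_Re2_Im2. Qed.

Lemma sqnormc_ge0 z : 0 <= sqnormc z.
Proof. by rewrite -ler0c sqnormcE exprn_ge0. Qed.

Lemma sqnormc_eq0 z : (sqnormc z == 0) = (z == 0).
Proof. by rewrite -(inj_eq (@complexI R)) sqnormcE expf_eq0 /= normr_eq0. Qed.

Lemma sqnormcM y z : sqnormc (y * z) = sqnormc y * sqnormc z.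
Proof. by rewrite /sqnormc; case: y z => a b [c d] /=; ring. Qed.

Lemma sqnormc_conj z : sqnormc z^*%R = sqnormc z.
Proof. by rewrite /sqnormc; case: z => a b /=; rewrite sqrrN. Qed.

Lemma sqnormcN z : sqnormc (- z) = sqnormc z.
Proof. by rewrite /sqnormc; case: z => a b /=; rewrite !sqrrN. Qed.

Lemma sqnormc_real (x : R) : sqnormc x%:C = x ^+ 2.
Proof. by rewrite /sqnormc /= expr0n addr0. Qed.

Lemma dotL2_sqnormc (N : nat) (mu : 'I_N -> R) f :
  dotL2 mu f f = (\sum_k mu k * sqnormc (f k))%:C.
Proof.
rewrite dotL2_real rmorph_sum; apply: eq_bigr => k _.
by rewrite -sqnormcE; exact/esym/rmorphM.
Qed.

(** For positive [mu] and a unit vector [f] this is a convex combination of the [w k], as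
    [line_convex_support] requires. *)
Lemma dotL2_mulz (N : nat) (w : 'I_N -> R[i]) (mu : 'I_N -> R) f :
  dotL2 mu f (mulzL2 w f) = \sum_k (mu k * sqnormc (f k))%:C * w k.
Proof.
rewrite /dotL2; apply: eq_bigr => k _.
rewrite ffunE realM sqnormcE normCK -!mulrA; congr (_ * _).
by rewrite [w k * _]mulrC mulrCA.
Qed.

Lemma sum_pair (T : nmodType) (N : nat) (F : 'I_N -> T) (j k : 'I_N) :
  j != k -> (forall i, i != j -> i != k -> F i = 0) -> \sum_i F i = F j + F k.
Proof.
move=> jk F0; rewrite (bigD1 j) //= (bigD1 k) 1?eq_sym //= big1 ?addr0 //.
by move=> i /andP[]; exact: F0.
Qed.

Lemma ordS_neq (n : nat) (j : 'I_n.+1) : (1 <= n)%N -> j != ordS j.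
Proof.
move=> n1; rewrite -(inj_eq val_inj) /=; have := ltn_ord j.
rewrite ltnS leq_eqVlt => /orP[/eqP jn|jn].
  by rewrite jn modnn -lt0n.
by rewrite modn_small // neq_ltn ltnSn.
Qed.

(** * The numerical range on the line through two neighbouring zeros *)

Section Edge.
Variables (n : nat) (w : 'I_n.+1 -> R[i]) (mu : 'I_n.+1 -> R).
Variable (e : {ffun 'I_n.+1 -> R[i]}) (V : set {ffun 'I_n.+1 -> R[i]}).
Hypotheses (n1 : (1 <= n)%N) (wc : cyclically_ordered w) (mu0 : forall j, 0 < mu j).
Hypotheses (VP : forall f, V f <-> dotL2 mu e f = 0) (e1 : dotL2 mu e e = 1).
Hypothesis e0 : forall j, e j != 0.
Variable j : 'I_n.+1.

(** The real counterpart of [eigmass] when [e] is [phi n]. *)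
Definition mass (k : 'I_n.+1) : R := mu k * sqnormc (e k).

Lemma mass_gt0 k : 0 < mass k.
Proof. by rewrite mulr_gt0 // lt_neqAle sqnormc_ge0 eq_sym sqnormc_eq0 e0. Qed.

(** The weight of [w (ordS j)] in the point that divides the edge from [w j] in the ratio of the
    masses. *)
Definition edge_ratio : R := mass j / (mass j + mass (ordS j)).

Lemma edge_ratioP : [/\ 0 < edge_ratio, edge_ratio < 1
  & edge_ratio * mass (ordS j) = (1 - edge_ratio) * mass j].
Proof.
have mj := mass_gt0 j; have mS := mass_gt0 (ordS j); rewrite /edge_ratio.
have s0 := addr_gt0 mj mS; split; first exact: divr_gt0.
  by rewrite ltr_pdivrMr // mul1r ltrDl.
by field; rewrite gt_eqF.
Qed.

Definition edge_point : R[i] :=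
  (1 - edge_ratio)%:C * w j + edge_ratio%:C * w (ordS j).

(** Only two coordinates of [psi] survive; orthogonality to [e] and the unit norm are then two
    linear equations for their weights. *)
Lemma edge_numrange_sub z : line (w j) (w (ordS j)) z ->
  numerical_range mu V (compression mu V (mulzL2 w)) z -> z = edge_point.
Proof.
move=> zl /(numerical_range_compression _ _ _ mu0 _ _ VP e1)[psi [/VP psie]].
rewrite dotL2_sqnormc dotL2_mulz => /complexI psi1 zE.
set a := fun k => mu k * sqnormc (psi k) in psi1 zE.
have jS := ordS_neq _ j n1.
have a0 k : 0 <= a k by rewrite mulr_ge0 ?sqnormc_ge0 // ltW.
have psi0 k : k != j -> k != ordS j -> psi k = 0.
  move=> kj kSj; rewrite zE in zl.
  have /eqP := line_convex_support _ _ _ _ _ wc a0 psi1 zl k kj kSj.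
  by rewrite mulf_eq0 gt_eqF //= sqnormc_eq0 => /eqP.
have ak0 k : k != j -> k != ordS j -> a k = 0.
  by move=> kj kSj; rewrite /a psi0 // /sqnormc /= expr0n addr0 mulr0.
rewrite (sum_pair _ _ _ _ _ jS) // in psi1.
rewrite (sum_pair _ _ _ _ _ jS) in zE; last by move=> k kj kS; rewrite [mu k * _]ak0 // mul0r.
move: psie; rewrite /dotL2 (sum_pair _ _ _ _ _ jS); last first.
  by move=> k kj kS; rewrite psi0 // !mulr0.
(* The two remaining terms are opposite, so their squared moduli agree; this becomes the balance
   [hm] of weights and masses. *)
move=> /eqP; rewrite addr_eq0 => /eqP /(congr1 sqnormc).
rewrite sqnormcN !sqnormcM !sqnormc_conj !sqnormc_real => h.
have [_ _ hr] := edge_ratioP.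
have hm : a j * mass j = a (ordS j) * mass (ordS j).
  by move: h; rewrite /a /mass => h; lra.
have mj := mass_gt0 j; have mS := mass_gt0 (ordS j).
have aS : a (ordS j) = edge_ratio.
  apply: (mulIf (x := mass j + mass (ordS j))); first by rewrite gt_eqF ?addr_gt0.
  by rewrite /edge_ratio divfK ?gt_eqF ?addr_gt0 // mulrDr -hm -mulrDl [_ + a j]addrC psi1 mul1r.
by rewrite zE /edge_point -aS -psi1 addrK.
Qed.

(** The vector [psi] lives on the two end points; its entries are the conjugated entries of [e],
    swapped and with opposite signs, so that the pairing with [e] cancels. *)
Lemma edge_point_numrange :
  numerical_range mu V (compression mu V (mulzL2 w)) edge_point.
Proof.
apply/(numerical_range_compression _ _ _ mu0 _ _ VP e1).
have jS := ordS_neq _ j n1; have Sj : ordS j != j by rewrite eq_sym.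
have mj := mass_gt0 j; have mS := mass_gt0 (ordS j).
have muj := mu0 j; have muS := mu0 (ordS j).
(* Without the factor [s] the squared norm of [psi] would be [d]. *)
pose d := mu j * mu (ordS j) * (mass j + mass (ordS j)).
have d0 : 0 < d by rewrite !mulr_gt0 // addr_gt0.
pose s := Num.sqrt d^-1.
have s2 : s ^+ 2 = d^-1 by rewrite sqr_sqrtr // invr_ge0 ltW.
pose psi : {ffun 'I_n.+1 -> R[i]} := [ffun k =>
  if k == j then (s * mu (ordS j))%:C * (e (ordS j))^*%R
  else if k == ordS j then - ((s * mu j)%:C * (e j)^*%R) else 0].
have psij : psi j = (s * mu (ordS j))%:C * (e (ordS j))^*%R by rewrite ffunE eqxx.
have psiS : psi (ordS j) = - ((s * mu j)%:C * (e j)^*%R).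
  by rewrite ffunE (negbTE Sj) eqxx.
have psi0 k : k != j -> k != ordS j -> psi k = 0.
  by move=> kj kS; rewrite ffunE (negbTE kj) (negbTE kS).
have ak0 k : k != j -> k != ordS j -> mu k * sqnormc (psi k) = 0.
  by move=> kj kSj; rewrite psi0 // /sqnormc /= expr0n addr0 mulr0.
have aj : mu j * sqnormc (psi j) = 1 - edge_ratio.
  rewrite psij sqnormcM sqnormc_conj sqnormc_real exprMn s2 /edge_ratio /d.
  by move: (addr_gt0 mj mS); rewrite /mass => m0; field; rewrite !gt_eqF.
have aS : mu (ordS j) * sqnormc (psi (ordS j)) = edge_ratio.
  rewrite psiS sqnormcN sqnormcM sqnormc_conj sqnormc_real exprMn s2 /edge_ratio /d.
  by move: (addr_gt0 mj mS); rewrite /mass => m0; field; rewrite !gt_eqF.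
exists psi; split.
- apply/VP; rewrite /dotL2 (sum_pair _ _ _ _ _ jS).
    have cancel (F : comNzRingType) (a b c x y : F) :
      a * (x * (c * b * y)) + b * (y * - (c * a * x)) = 0 by ring.
    by rewrite psij psiS !realM; exact: cancel.
  by move=> k kj kS; rewrite psi0 // !mulr0.
- by rewrite dotL2_sqnormc (sum_pair _ _ _ _ _ jS) // aj aS subrK.
- rewrite dotL2_mulz (sum_pair _ _ _ _ _ jS) ?aj ?aS //.
  by move=> k kj kS; rewrite [mu k * _]ak0 // mul0r.
Qed.

Lemma edge_point_segment : segment (w j) (w (ordS j)) edge_point.
Proof.
have [r0 r1 _] := edge_ratioP.
by exists edge_ratio => //; rewrite !ltW.
Qed.

Lemma edge_point_dist :
  `|edge_point - w j| = edge_ratio%:C * `|w (ordS j) - w j| /\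
  `|edge_point - w (ordS j)| = (1 - edge_ratio)%:C * `|w (ordS j) - w j|.
Proof.
have [r0 r1 _] := edge_ratioP.
have r0C : 0 <= edge_ratio%:C by rewrite ler0c ltW.
have r1C : 0 <= (1 - edge_ratio)%:C by rewrite ler0c subr_ge0 ltW.
have rC : (1 - edge_ratio)%:C = 1 - edge_ratio%:C by exact: rmorphB.
have dj (F : comNzRingType) (t a b : F) : (1 - t) * a + t * b - a = t * (b - a).
  by ring.
have dS (F : comNzRingType) (t a b : F) : (1 - t) * a + t * b - b = (1 - t) * (a - b).
  by ring.
split; rewrite -[X in X * _]ger0_norm //.
  by rewrite -normrM /edge_point rC; congr (`|_|); exact: dj.
by rewrite [`|w _ - w _|]distrC -normrM /edge_point rC; congr (`|_|); exact: dS.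
Qed.

(** Keeps the denominator of the distance ratio nonzero: [w j] has positive weight, and neighbouring
    zeros are distinct. *)
Lemma edge_point_neq : edge_point != w (ordS j).
Proof.
have [r0 r1 _] := edge_ratioP; have [_ dS] := edge_point_dist.
rewrite -subr_eq0 -normr_eq0 dS mulf_neq0 //.
  by rewrite gt_eqF // (ltcR 0) subr_gt0.
rewrite normr_eq0 subr_eq0 (inj_eq (cyclically_ordered_inj _ _ _ wc)) eq_sym.
exact: ordS_neq.
Qed.

Lemma edge_point_mass :
  `|edge_point - w j| * (mass (ordS j))%:C = `|edge_point - w (ordS j)| * (mass j)%:C.
Proof.
have [-> ->] := edge_point_dist; have [_ _ h] := edge_ratioP.
by rewrite mulrAC [RHS]mulrAC -!realM h.
Qed.

End Edge.
End NumericalRange.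

Theorem theorem4 (R : realType) (n : nat) (alpha : nat -> R[i]) (lambda : R[i])
    (w : 'I_n.+1 -> R[i]) (mu : 'I_n.+1 -> R)
    (hn : (1 <= n)%N)
    (halpha : forall j : nat, (j < n)%N -> `|alpha j| < 1)
    (hlambda : `|lambda| = 1)
    (hw_zeros : forall z : R[i],
       root (popuc alpha lambda n) z <-> exists j : 'I_n.+1, z = w j)
    (hw_cyclic : cyclically_ordered w)
    (hmu : is_popuc_measure alpha w mu) :
  let m := eigmass alpha lambda w mu in
  exists zeta : 'I_n.+1 -> R[i],
    (forall j : 'I_n.+1,
       [/\ line (w j) (w (ordS j)) `&` numrange_compressed_mul w mu
             = [set zeta j],
           segment (w j) (w (ordS j)) (zeta j),
           zeta j != w (ordS j),
           m (ordS j) != 0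
         & `|zeta j - w j| / `|zeta j - w (ordS j)| = m j / m (ordS j)])
    /\ \prod_(j < n.+1) `|zeta j - w j|
       = \prod_(j < n.+1) `|zeta j - w (ordS j)|.
Proof.
move=> m.
have w_inj := cyclically_ordered_inj R _ w hw_cyclic.
have w_root j : root (popuc alpha lambda n) (w j) by apply/hw_zeros; exists j.
have [mu0 _ orth] := hmu.
set e := toL2 w (phi alpha n).
have e1 : dotL2 mu e e = 1 by rewrite orth // eqxx.
have e0 j : e j != 0.
  by rewrite ffunE (phi_root_neq0 R n alpha lambda w mu halpha w_inj w_root hmu).
have VP := polyL2P R n alpha lambda w mu halpha w_inj w_root hmu.
have mE j : m j = (mass R n mu e j)%:C.
  rewrite /m (eigmassE R n alpha lambda w mu w_inj w_root hmu).
  by rewrite /mass realM sqnormcE ffunE.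
have m0 j : m j != 0 by rewrite mE gt_eqF // (ltcR 0) mass_gt0.
pose zeta := edge_point R n w mu e.
have zeta_mass j : `|zeta j - w j| * m (ordS j) = `|zeta j - w (ordS j)| * m j.
  by rewrite !mE; exact: edge_point_mass.
have zeta_neq j : zeta j != w (ordS j) by exact: edge_point_neq.
exists zeta; split=> [j|].
  split=> //.
  - apply/seteqP; split=> z /=.
      by case; exact: (edge_numrange_sub _ _ _ _ _ _ hn hw_cyclic mu0 VP e1 e0).
    move=> ->; split; last exact: (edge_point_numrange _ _ _ _ _ _ hn mu0 VP e1 e0).
    by have [t _ zetaE] := edge_point_segment R n w mu e mu0 e0 j; exists t.
  - exact: edge_point_segment.
  - apply/eqP; rewrite eqr_div ?m0 ?normr_eq0 ?subr_eq0 ?zeta_neq //.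
    by rewrite zeta_mass mulrC.
(* Unification would otherwise unfold [m] into its defining square. *)
clearbody zeta m.
(* The cross-multiplied relations are multiplied over all edges; [ordS] permutes the indices, so the
   masses have equal products on both sides and cancel. *)
have : \prod_(j < n.+1) (`|zeta j - w j| * m (ordS j)) =
       \prod_(j < n.+1) (`|zeta j - w (ordS j)| * m j).
  by apply: eq_bigr => j _; exact: zeta_mass.
have mS : \prod_(j < n.+1) m (ordS j) = \prod_(j < n.+1) m j.
  by rewrite [RHS](reindex_inj (@ordS_inj n.+1)).
rewrite big_split [RHS]big_split /= mS; apply: mulIf.
by apply/prodf_neq0 => j _; exact: m0.
Qed.
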